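(* Let $m,n\ge 1$ and let $\varphi:\mathbb{S}^m\to\mathbb{S}^n$ be a non-constant quadratic form. Then $\varphi$ is proper biharmonic if and only if its energy density $e(\varphi)$ is constant and equal to $(m+1)/2$.
   Context: $\mathbb{S}^m$ denotes the unit Euclidean sphere in $\mathbb{R}^{m+1}$ with its standard round metric. A quadratic form $\varphi:\mathbb{S}^m\to\mathbb{S}^n$ is the restriction to $\mathbb{S}^m$ of a map $F:\mathbb{R}^{m+1}\to\mathbb{R}^{n+1}$ all of whose components are homogeneous polynomials of degree $2$ and which satisfies $|F(\overline x)|=1$ whenever $|\overline x|=1$. The energy density of a smooth map $\varphi:(M,g)\to(N,h)$ is $e(\varphi)=\frac12|d\varphi|^2$ (Hilbert–Schmidt norm). The tension field is $\tau(\varphi)=\mathrm{trace}\,\nabla d\varphi$; $\varphi$ is harmonic if $\tau(\varphi)=0$. For $M$ compact, $\varphi$ is biharmonic if it is a critical point of the bienergy $E_2(\varphi)=\frac12\int_M|\tau(\varphi)|^2\,v_g$; equivalently, $\tau_2(\varphi)=-\Delta\tau(\varphi)-\mathrm{trace}\,R^N(d\varphi(\cdot),\tau(\varphi))d\varphi(\cdot)=0$, where $\Delta\sigma=-\mathrm{trace}\,\nabla^2\sigma$ and $R(X,Y)Z=\nabla_X\nabla_YZ-\nabla_Y\nabla_XZ-\nabla_{[X,Y]}Z$. A map is proper biharmonic if it is biharmonic but not harmonic. *)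

(* Defs.v *)
From HB Require Import structures.
From mathcomp Require Import all_boot all_order all_algebra.
(* mpoly is not imported: its notations clash with those of MathComp-Analysis. *)
From mathcomp Require mpoly.
From mathcomp Require Import all_classical all_reals all_analysis.

Set Implicit Arguments.
Unset Strict Implicit.
Unset Printing Implicit Defensive.

Import Order.TTheory GRing.Theory Num.Theory.
Import numFieldNormedType.Exports.

Local Open Scope classical_set_scope.
Local Open Scope ring_scope.

(* The sphere S^n is treated as an embedded submanifold of R^{n+1} with the
   induced (round) metric: the tangent space at p is the orthogonal complement
   of p, vector fields are maps into the ambient space, and the Levi-Civita
   connection is the tangential part of the ambient derivative. *)

Section Sphere.
Variable R : realType.

Definition dot n (u v : 'rV[R]_n) : R := \sum_(i < n) u 0 i * v 0 i.

(* The norm that MathComp-Analysis puts on 'rV[R]_n is the sup norm. *)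
Definition enorm n (u : 'rV[R]_n) : R := Num.sqrt (dot u u).

Definition sphere n := {x : 'rV[R]_n.+1 | dot x x == 1}.

Definition tangent n (p : sphere n) (v : 'rV[R]_n.+1) : Prop :=
  dot v (val p) = 0.

Definition tproj n (p : sphere n) (v : 'rV[R]_n.+1) : 'rV[R]_n.+1 :=
  v - dot v (val p) *: val p.

Lemma dot_delta0 n :
  dot (delta_mx 0 0 : 'rV[R]_n.+1) (delta_mx 0 0) == 1.
Proof.
rewrite /dot (bigD1 ord0) //= big1 ?addr0 ?mxE ?eqxx ?mulr1 // => i /negbTE i0.
by rewrite mxE i0 andbF mul0r.
Qed.

Definition north n : sphere n := exist _ (delta_mx 0 0) (dot_delta0 n).

(* y |-> y / |y| for y != 0; the value at 0 is irrelevant. *)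
Definition radial n (y : 'rV[R]_n.+1) : sphere n :=
  insubd (north n) ((enorm y)^-1 *: y).

(* Derivative at x, in the tangent direction v, of a map defined on the sphere
   only.  The map is extended off the sphere by the radial retraction; on
   tangent vectors the result does not depend on the extension. *)
Definition sder n (V : normedModType R) (f : sphere n -> V)
    (x : sphere n) (v : 'rV[R]_n.+1) : V :=
  'D_v (fun y => f (radial y)) (val x).

Definition differential m n (phi : sphere m -> sphere n)
    (x : sphere m) (v : 'rV[R]_m.+1) : 'rV[R]_n.+1 :=
  sder (fun y => val (phi y)) x v.

(* The pull-back connection on phi^{-1} T S^n, applied to a section s along a
   vector field X of S^m. *)
Definition pullback_nabla m n (phi : sphere m -> sphere n)
    (X : sphere m -> 'rV[R]_m.+1) (s : sphere m -> 'rV[R]_n.+1) :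
    sphere m -> 'rV[R]_n.+1 :=
  fun x => tproj (phi x) (sder s x (X x)).

Definition nabla n (X Y : sphere n -> 'rV[R]_n.+1) :
    sphere n -> 'rV[R]_n.+1 :=
  pullback_nabla id X Y.

Definition lie_bracket n (X Y : sphere n -> 'rV[R]_n.+1) :
    sphere n -> 'rV[R]_n.+1 :=
  fun p => sder Y p (X p) - sder X p (Y p).

(* Extension of a tangent vector at a point to a vector field on the sphere;
   used to evaluate tensorial expressions on tangent vectors. *)
Definition extend n (v : 'rV[R]_n.+1) : sphere n -> 'rV[R]_n.+1 :=
  fun y => tproj y v.

Definition curvature n (X Y Z : sphere n -> 'rV[R]_n.+1) :
    sphere n -> 'rV[R]_n.+1 :=
  fun p => nabla X (nabla Y Z) p - nabla Y (nabla X Z) p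
           - nabla (lie_bracket X Y) Z p.

Definition curvature_at n (p : sphere n) (u v w : 'rV[R]_n.+1) : 'rV[R]_n.+1 :=
  curvature (extend u) (extend v) (extend w) p.

(* The rows of E form an orthonormal basis of the tangent space at x. *)
Definition orthonormal_frame m (x : sphere m) (E : 'M[R]_(m, m.+1)) : Prop :=
  (forall i, tangent x (row i E)) /\
  (forall i j, dot (row i E) (row j E) = (i == j)%:R).

Definition frame m (x : sphere m) : 'M[R]_(m, m.+1) :=
  xget 0 [set E | orthonormal_frame x E].

(* Metric trace over the tangent space at x; for bilinear B it does not depend
   on the chosen orthonormal basis. *)
Definition trace m (V : zmodType) (x : sphere m)
    (B : 'rV[R]_m.+1 -> 'rV[R]_m.+1 -> V) : V :=
  \sum_(i < m) B (row i (frame x)) (row i (frame x)).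

Definition energy_density m n (phi : sphere m -> sphere n) (x : sphere m) : R :=
  2^-1 * trace x
    (fun u v => dot (differential phi x u) (differential phi x v)).

Definition nabla_differential m n (phi : sphere m -> sphere n)
    (X Y : sphere m -> 'rV[R]_m.+1) : sphere m -> 'rV[R]_n.+1 :=
  fun x => pullback_nabla phi X (fun y => differential phi y (Y y)) x
           - differential phi x (nabla X Y x).

Definition tension m n (phi : sphere m -> sphere n) :
    sphere m -> 'rV[R]_n.+1 :=
  fun x => trace x (fun u v => nabla_differential phi (extend u) (extend v) x).

Definition harmonic m n (phi : sphere m -> sphere n) : Prop :=
  forall x, tension phi x = 0.

Definition nabla2 m n (phi : sphere m -> sphere n)
    (s : sphere m -> 'rV[R]_n.+1) (X Y : sphere m -> 'rV[R]_m.+1) :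
    sphere m -> 'rV[R]_n.+1 :=
  fun x => pullback_nabla phi X (pullback_nabla phi Y s) x
           - pullback_nabla phi (nabla X Y) s x.

(* Sign convention: Delta = - trace nabla^2. *)
Definition rough_laplacian m n (phi : sphere m -> sphere n)
    (s : sphere m -> 'rV[R]_n.+1) : sphere m -> 'rV[R]_n.+1 :=
  fun x => - trace x (fun u v => nabla2 phi s (extend u) (extend v) x).

Definition bitension m n (phi : sphere m -> sphere n) :
    sphere m -> 'rV[R]_n.+1 :=
  fun x => - rough_laplacian phi (tension phi) x
    - trace x (fun u v =>
        curvature_at (phi x) (differential phi x u) (tension phi x)
                     (differential phi x v)).

(* The Euler-Lagrange equation of the bienergy. *)
Definition biharmonic m n (phi : sphere m -> sphere n) : Prop :=
  forall x, bitension phi x = 0.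

Definition proper_biharmonic m n (phi : sphere m -> sphere n) : Prop :=
  biharmonic phi /\ ~ harmonic phi.

(* mpoly.dhomog k R d is the type of homogeneous polynomials of degree d (or
   zero) in k variables.  That F maps unit vectors to unit vectors is implied by
   the type of phi. *)
Definition quadratic_form m n (phi : sphere m -> sphere n) : Prop :=
  exists F : 'I_n.+1 -> mpoly.dhomog m.+1 R 2,
    forall x : sphere m,
      val (phi x) =
      \row_i mpoly.meval (fun j => val x 0 j) (mpoly.mpoly_of_dhomog (F i)).

Definition constant_map m n (phi : sphere m -> sphere n) : Prop :=
  exists c, forall x, phi x = c.

End Sphere.

(* Main.v *)
(* The sum [c] of the values of the polarisation [B] of the quadratic map on an
   orthonormal basis is constant, and the tension field is [2 V], where
   [V = c - <c, phi> phi] is the tangential part of [c] along [phi].  With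
   [f = <c, phi>], polarising [|B(u, u)|^2 = |u|^4] gives
   [e(phi) = m + 1 - f], and the bitension field is
   [-4 dphi(grad f) + 4 (m + 1 - 2 f) V].  Pairing with [c] yields
   [|grad f|^2 = (m + 1 - 2 f) (|c|^2 - f^2)].  On each coordinate great
   circle only the term [2 f^3] can have degree 6, so the quadratic form [f] is
   constant on the sphere.  Then either [f = (m + 1) / 2] or
   [|V|^2 = |c|^2 - f^2 = 0], the latter meaning that [phi] is harmonic. *)
Require Import Defs.
From mathcomp Require Import all_boot all_order all_algebra.
From mathcomp Require mpoly.
From mathcomp Require Import ring lra.
From mathcomp Require Import all_classical all_reals all_analysis.

Local Open Scope ring_scope.

Section QuadraticForms.
Set Implicit Arguments.
Unset Strict Implicit.
Unset Printing Implicit Defensive.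
Import Order.TTheory GRing.Theory Num.Theory.
Import numFieldNormedType.Exports.
Local Open Scope classical_set_scope.
Context {R : realType}.

(** * The Euclidean inner product *)

Section Dot.
Context {n : nat}.
Implicit Types u v w : 'rV[R]_n.

Lemma dotC u v : dot u v = dot v u.
Proof. by apply: eq_bigr => i _; rewrite mulrC. Qed.

Lemma dotDl u v w : dot (u + v) w = dot u w + dot v w.
Proof. by rewrite -big_split; apply: eq_bigr => i _; rewrite mxE mulrDl. Qed.

Lemma dotZl k u v : dot (k *: u) v = k * dot u v.
Proof. by rewrite mulr_sumr; apply: eq_bigr => i _; rewrite mxE mulrA. Qed.

Lemma dotNl u v : dot (- u) v = - dot u v.
Proof. by rewrite -scaleN1r dotZl mulN1r. Qed.

Lemma dotBl u v w : dot (u - v) w = dot u w - dot v w.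
Proof. by rewrite dotDl dotNl. Qed.

Lemma dotDr u v w : dot u (v + w) = dot u v + dot u w.
Proof. by rewrite dotC dotDl !(dotC _ u). Qed.

Lemma dotZr k u v : dot u (k *: v) = k * dot u v.
Proof. by rewrite dotC dotZl dotC. Qed.

Lemma dotNr u v : dot u (- v) = - dot u v.
Proof. by rewrite dotC dotNl dotC. Qed.

Lemma dotBr u v w : dot u (v - w) = dot u v - dot u w.
Proof. by rewrite dotDr dotNr. Qed.

Lemma dot0l u : dot 0 u = 0.
Proof. by rewrite -(scale0r 0) dotZl mul0r. Qed.

Lemma dot0r u : dot u 0 = 0.
Proof. by rewrite dotC dot0l. Qed.

Lemma dot_sumr I (r : seq I) (P : pred I) u (F : I -> 'rV[R]_n) :
  dot u (\sum_(i <- r | P i) F i) = \sum_(i <- r | P i) dot u (F i).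
Proof. by elim/big_rec2 : _ => [|i ? ? _ <-]; rewrite ?dot0r ?dotDr. Qed.

Definition dotE := (dotDl, dotDr, dotNl, dotNr, dotZl, dotZr).

Lemma dotvv_ge0 u : 0 <= dot u u.
Proof. by apply: sumr_ge0 => i _; rewrite -expr2 sqr_ge0. Qed.

Lemma dotvv_eq0 u : dot u u = 0 -> u = 0.
Proof.
move=> /eqP; rewrite psumr_eq0 => [/allP u0|i _]; last first.
  by rewrite -expr2 sqr_ge0.
apply/rowP => i; rewrite mxE; have := u0 i (mem_index_enum _).
by rewrite /= -expr2 sqrf_eq0 => /eqP.
Qed.

Lemma dot_mx u v : (u *m v^T) 0 0 = dot u v.
Proof. by rewrite mxE; apply: eq_bigr => i _; rewrite mxE. Qed.

Lemma dot_delta u j : dot u (delta_mx 0 j) = u 0 j.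
Proof.
rewrite /dot (bigD1 j) //= big1 ?addr0 ?mxE ?eqxx ?mulr1 // => i /negbTE ij.
by rewrite mxE ij andbF mulr0.
Qed.

End Dot.

(** * Orthonormal frames and metric traces *)

Section Frame.
Context {m : nat}.
Implicit Type x : sphere R m.

Lemma dot_sphere x : dot (val x) (val x) = 1.
Proof. exact/eqP/(valP x). Qed.

Lemma orthonormal_frame_exists x : exists E, orthonormal_frame x E.
Proof.
have [w wE] : exists w, w = delta_mx 0 0 - val x by eexists.
have [N NE] : exists N, N = dot w w by eexists.
(* Rows of the Householder reflection exchanging [x] and the first basis vector;
   it is the identity when [N = 0], as then [2 / N = 0]. *)
pose h i := delta_mx 0 i - (2 / N * w 0 i) *: w.
have dd i j : dot (delta_mx 0 i : 'rV[R]_m.+1) (delta_mx 0 j) = (i == j)%:R.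
  by rewrite dot_delta mxE eqxx eq_sym.
have hh i j : dot (h i) (h j) = (i == j)%:R.
  rewrite /h !dotE -NE dd (dotC _ w) !dot_delta.
  have [->|N0] := eqVneq N 0; first by rewrite invr0 !(mulr0, mul0r); ring.
  by field.
have hx : h 0 = val x.
  have Nw : N = 2 * w 0 0.
    rewrite NE wE !dotE dot_sphere dd eqxx (dotC _ (val x)) dot_delta.
    by rewrite !mxE !eqxx /=; ring.
  rewrite /h; have [N0|N0] := eqVneq N 0.
    have /dotvv_eq0 w0 : dot w w = 0 by rewrite -NE.
    by rewrite w0 scaler0 subr0; apply/eqP; rewrite -subr_eq0 -wE w0.
  (* As [N = 2 * w 0 0], the coefficient of [w] in [h 0] is 1, and subtracting [w] from the first
     basis vector leaves [x]. *)
  rewrite [X in X *: _](_ : _ = 1); last first.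
    by apply: (@mulfI _ N) => //; rewrite {3}Nw; field.
  by rewrite scale1r wE subKr.
(* Row 0 of the reflection is [x] itself; the other [m] rows span its orthogonal complement. *)
exists (\matrix_(i < m, j < m.+1) h (lift 0 i) 0 j).
have rowE i : row i (\matrix_(i < m, j < m.+1) h (lift 0 i) 0 j) = h (lift 0 i).
  by apply/rowP => j; rewrite !mxE.
split=> [i|i j]; rewrite !rowE; last by rewrite hh (inj_eq lift_inj).
by rewrite /tangent -hx hh.
Qed.

(** [frame] is an [xget] with default 0; the existence of an orthonormal frame excludes the
    default. *)
Lemma frameP x : orthonormal_frame x (frame x).
Proof.
have [E xE] := orthonormal_frame_exists x.
by rewrite /frame; case: xgetP => [//|/(_ E)/(_ xE)].
Qed.

Local Notation e x i := (row i (frame x)).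

Lemma dot_frame_l x i : dot (val x) (e x i) = 0.
Proof. by rewrite dotC; have [/(_ i)] := frameP x. Qed.

Lemma dot_frame x i : dot (e x i) (e x i) = 1.
Proof. by have [_ ->] := frameP x; rewrite eqxx. Qed.

(** Stacking [x] on its frame gives a square matrix [Q] with orthonormal rows. From [Q Q^T = 1]
    follows [Q^T Q = 1], written here in blocks of sizes 1 and [m]. *)
Lemma frame_resolution x :
  (val x)^T *m val x + (frame x)^T *m frame x = 1%:M.
Proof.
have [] := frameP x; rewrite /tangent.
move: (val x) (frame x) (dot_sphere x); rewrite -[m.+1]add1n.
move=> u E uu xE EE; rewrite -mul_row_col -tr_col_mx; apply: mulmx1C.
have dotrow i j : (E *m E^T) i j = dot (row i E) (row j E).
  by rewrite mxE; apply: eq_bigr => k _; rewrite !mxE.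
rewrite tr_col_mx mul_col_row scalar_mx_block.
congr block_mx; apply/matrixP => i j; rewrite ?ord1.
- by rewrite dot_mx uu mxE eqxx.
- rewrite [RHS]mxE -(xE j) dotC !mxE.
  by apply: eq_bigr => k _; rewrite !mxE.
- by rewrite [RHS]mxE -(xE i) !mxE; apply: eq_bigr => k _; rewrite !mxE.
- by rewrite dotrow EE mxE.
Qed.

(** Multiply [A] by the resolution of the identity and use cyclicity of the trace: the full trace
    splits into a tangential and a normal part. *)
Lemma trace_mx x (A : 'M[R]_m.+1) :
  trace x (fun u v => (u *m A *m v^T) 0 0) =
  \tr A - (val x *m A *m (val x)^T) 0 0.
Proof.
apply/eqP; rewrite eq_sym subr_eq; apply/eqP; rewrite -[in LHS](mulmx1 A).
rewrite -(frame_resolution x) mulmxDr linearD /= !mulmxA addrC; congr (_ + _).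
  rewrite mxtrace_mulC mulmxA /mxtrace; apply: eq_bigr => i _.
  by rewrite -row_mul mxE [RHS]mxE; apply: eq_bigr => j _; rewrite !mxE.
by rewrite mxtrace_mulC mulmxA /mxtrace big_ord1.
Qed.

(** The rank-one case [A = u^T w] of [trace_mx]: Parseval for the tangential parts of [u] and
    [w]. *)
Lemma trace_dot x u w :
  trace x (fun a b => dot u a * dot w b) =
  dot u w - dot u (val x) * dot w (val x).
Proof.
have h a b : dot u a * dot w b = (a *m (u^T *m w) *m b^T) 0 0.
  rewrite !mulmxA -mulmxA mxE big_ord1 !dot_mx.
  by rewrite (dotC a).
transitivity (trace x (fun a b => (a *m (u^T *m w) *m b^T) 0 0)).
  by apply: eq_bigr => i _; rewrite h.
rewrite trace_mx h mxtrace_mulC /mxtrace big_ord1 (dot_mx w) (dotC u w).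
by [].
Qed.

End Frame.

(** * Directional derivatives of matrix-valued maps *)

Lemma is_derive_mx (V : normedModType R) p q (M : V -> 'M[R]_(p, q)) x v
    (d : 'M[R]_(p, q)) :
  (forall i j, is_derive x v (fun y => M y i j) (d i j)) -> is_derive x v M d.
Proof.
move=> dM; have Mx : derivable M x v.
  by apply/derivable_mxP => i j; have [] := dM i j.
apply: DeriveDef => //; rewrite derive_mx //; apply/matrixP => i j; rewrite mxE.
by have [] := dM i j.
Qed.

Lemma is_derive_entry (V : normedModType R) p q (M : V -> 'M[R]_(p, q)) x v
    (d : 'M[R]_(p, q)) i j :
  is_derive x v M d -> is_derive x v (fun y => M y i j) (d i j).
Proof.
move=> [Mx <-]; have /derivable_mxP/(_ i j) Mij := Mx.
by apply: DeriveDef => //; rewrite derive_mx // mxE.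
Qed.

Lemma is_derive_line (V W : normedModType R) (f : V -> W) x v d :
  is_derive (0 : R) 1 (fun h : R => f (h *: v + x)) d -> is_derive x v f d.
Proof.
move=> [fx <-]; apply: DeriveDef; first exact/derivable1P.
rewrite /derive; set g1 := fun h => h^-1 *: _; set g2 := fun h => h^-1 *: _.
suff -> : g1 = g2 by [].
by apply/funext => h; rewrite /g1 /g2 /= addr0 scale0r add0r [_%:A]mulr1.
Qed.

(** * Differential calculus on the sphere *)

Section Calculus.
Context {n : nat}.
Implicit Types (x : sphere R n) (v : 'rV[R]_n.+1).

Lemma radial_val x : radial (val x) = x.
Proof.
apply: val_inj; rewrite /radial /enorm dot_sphere sqrtr1 invr1 scale1r.
by rewrite val_insubd dot_sphere eqxx.
Qed.

Lemma val_radial (y : 'rV[R]_n.+1) : 0 < dot y y ->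
  val (radial y) = (Num.sqrt (dot y y))^-1 *: y.
Proof.
move=> y0; rewrite /radial val_insubd !dotE mulrA -invfM -expr2.
by rewrite sqr_sqrtr ?ltW // mulVf ?eqxx // gt_eqF.
Qed.

(** Carries differentiability along with the value, since [sder] is a total function and its value
    alone does not allow the usual rules. *)
Definition has_sder (V : normedModType R) (f : sphere R n -> V) x v d :=
  is_derive (val x) v (fun y => f (radial y)) d.

Lemma has_sderE (V : normedModType R) (f : sphere R n -> V) x v d :
  has_sder f x v d -> sder f x v = d.
Proof. by case. Qed.

Lemma has_sder_eq (V : normedModType R) (f : sphere R n -> V) x v d d' :
  has_sder f x v d -> d = d' -> has_sder f x v d'.
Proof. by move=> ? <-. Qed.

Lemma has_sder_cst (V : normedModType R) (c : V) x v : has_sder (fun=> c) x v 0.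
Proof. exact: is_derive_cst. Qed.

Lemma has_sderD (V : normedModType R) (f g : sphere R n -> V) x v df dg :
  has_sder f x v df -> has_sder g x v dg ->
  has_sder (fun y => f y + g y) x v (df + dg).
Proof. exact: is_deriveD. Qed.

Lemma has_sderN (V : normedModType R) (f : sphere R n -> V) x v df :
  has_sder f x v df -> has_sder (fun y => - f y) x v (- df).
Proof. exact: is_deriveN. Qed.

Lemma has_sderB (V : normedModType R) (f g : sphere R n -> V) x v df dg :
  has_sder f x v df -> has_sder g x v dg ->
  has_sder (fun y => f y - g y) x v (df - dg).
Proof. exact: is_deriveB. Qed.

Lemma has_sderZc (V : normedModType R) (k : R) (f : sphere R n -> V) x v df :
  has_sder f x v df -> has_sder (fun y => k *: f y) x v (k *: df).
Proof. exact: is_deriveZ. Qed.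

Lemma has_sderM (f g : sphere R n -> R) x v df dg :
  has_sder f x v df -> has_sder g x v dg ->
  has_sder (fun y => f y * g y) x v (df * g x + f x * dg).
Proof.
move=> fx gx; have := is_deriveM fx gx; rewrite radial_val => fg.
by apply: is_derive_eq fg _; rewrite addrC mulrC.
Qed.

Lemma has_sder_sum I (r : seq I) (f : I -> sphere R n -> R) x v df :
  (forall i, has_sder (f i) x v (df i)) ->
  has_sder (fun y => \sum_(i <- r) f i y) x v (\sum_(i <- r) df i).
Proof.
move=> fx; elim: r => [|i r IHr].
  rewrite big_nil (_ : (fun y => _) = fun=> 0); first exact: has_sder_cst.
  by apply/funext => y; rewrite big_nil.
rewrite big_cons (_ : (fun y => _) = fun y => f i y + \sum_(j <- r) f j y).
  exact: has_sderD.
by apply/funext => y; rewrite big_cons.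
Qed.

Lemma has_sder_mx p q (f : sphere R n -> 'M[R]_(p, q)) x v (df : 'M[R]_(p, q)) :
  (forall i j, has_sder (fun y => f y i j) x v (df i j)) -> has_sder f x v df.
Proof. exact: is_derive_mx. Qed.

Lemma has_sder_entry p q (f : sphere R n -> 'M[R]_(p, q)) x v
    (df : 'M[R]_(p, q)) i j :
  has_sder f x v df -> has_sder (fun y => f y i j) x v (df i j).
Proof. exact: is_derive_entry. Qed.

Lemma has_sder_mulmx p q r (f : sphere R n -> 'M[R]_(p, q))
    (g : sphere R n -> 'M[R]_(q, r)) x v df dg :
  has_sder f x v df -> has_sder g x v dg ->
  has_sder (fun y => f y *m g y) x v (df *m g x + f x *m dg).
Proof.
move=> fx gx; apply: has_sder_mx => i j; rewrite !mxE -big_split /=.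
rewrite (_ : (fun y => _) = fun y => \sum_k f y i k * g y k j).
  by apply: has_sder_sum => k; apply: has_sderM; exact: has_sder_entry.
by apply/funext => y; rewrite mxE.
Qed.

Lemma has_sder_tr p q (f : sphere R n -> 'M[R]_(p, q)) x v (df : 'M[R]_(p, q)) :
  has_sder f x v df -> has_sder (fun y => (f y)^T) x v df^T.
Proof.
move=> fx; apply: has_sder_mx => i j; rewrite mxE.
rewrite (_ : (fun y => _) = fun y => f y j i); first exact: has_sder_entry.
by apply/funext => y; rewrite mxE.
Qed.

Lemma has_sder_dot p (f g : sphere R n -> 'rV[R]_p) x v df dg :
  has_sder f x v df -> has_sder g x v dg ->
  has_sder (fun y => dot (f y) (g y)) x v (dot df (g x) + dot (f x) dg).
Proof.
move=> fx gx; rewrite -big_split.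
by apply: has_sder_sum => k; apply: has_sderM; exact: has_sder_entry.
Qed.

Lemma has_sderZ p (k : sphere R n -> R) (f : sphere R n -> 'rV[R]_p) x v dk df :
  has_sder k x v dk -> has_sder f x v df ->
  has_sder (fun y => k y *: f y) x v (dk *: f x + k x *: df).
Proof.
move=> kx fx; apply: has_sder_mx => i j; rewrite !mxE.
rewrite (_ : (fun y => _) = fun y => k y * f y i j).
  by apply: has_sderM => //; exact: has_sder_entry.
by apply/funext => y; rewrite mxE.
Qed.

(** Along the line [x + h v] the retraction is [(x + h v) / sqrt (q h)] with [q h = |x + h v|^2]. As
    [q 0 = 1] and [q' 0 = 2 <v, x>], the factor [1 / sqrt q] has derivative [- <v, x>] at 0. *)
Lemma has_sder_val x v : has_sder val x v (tproj x v).
Proof.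
apply: is_derive_line.
pose q (h : R) := 1 + 2 * h * dot v (val x) + h ^+ 2 * dot v v.
have qE h : dot (h *: v + val x) (h *: v + val x) = q h.
  by rewrite /q !dotE dot_sphere (dotC (val x)); ring.
have dq : is_derive (0 : R) 1 q (2 * dot v (val x)).
  rewrite (_ : q = cst 1 + (2 * dot v (val x)) *: id + dot v v *: (id ^+ 2)).
    apply: is_derive_eq; rewrite /GRing.scale /=; ring.
  by apply/funext => h; rewrite /q !fctE /GRing.scale /=; ring.
have q0 : q 0 = 1 by rewrite /q; ring.
have cq : {for 0, continuous q}.
  by apply/differentiable_continuous/derivable1_diffP; case: dq.
have ds : is_derive (0 : R) 1 (fun h => (Num.sqrt (q h))^-1) (- dot v (val x)).
  have dqq : is_derive (q 0) 1 Num.sqrt (2 * Num.sqrt (q 0))^-1.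
    by apply: is_derive1_sqrt; rewrite q0.
  have sn0 : (Num.sqrt \o q) 0 != 0 by rewrite /= q0 sqrtr1 oner_neq0.
  apply: is_derive_eq (is_deriveV sn0 (is_derive1_comp dqq dq)) _.
  by rewrite /= q0 sqrtr1 /GRing.scale /=; field.
have -> : tproj x v = (- dot v (val x)) *: val x + 1 *: v.
  by rewrite /tproj scaleNr scale1r addrC.
apply: (@near_eq_is_derive _ _ _
  (fun h => (Num.sqrt (q h))^-1 *: (h *: v + val x))).
  (* The closed formula for [radial] holds only away from the origin, hence for [h] near 0. *)
  have : \forall h \near (0 : R), 0 < q h.
    by apply: cvgr_gt cq _ _; rewrite q0.
  by apply: filterS => h qh; rewrite val_radial ?qE.
apply: is_derive_mx => i j; rewrite !mxE.
rewrite (_ : (fun y => _) =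
  (fun h => (Num.sqrt (q h))^-1) * (fun h => h * v i j + val x i j)).
  have dl : is_derive (0 : R) 1 (fun h => h * v i j + val x i j) (v i j).
    rewrite (_ : (fun h => _) = v i j *: id + cst (val x i j)).
      apply: is_derive_eq; rewrite /GRing.scale /=; ring.
    by apply/funext => h; rewrite !fctE /GRing.scale /= mulrC.
  apply: is_derive_eq.
  by rewrite /= q0 sqrtr1 /GRing.scale /=; field.
by apply/funext => h; rewrite !mxE.
Qed.

End Calculus.

(** * Tangential projection and curvature of the round sphere *)

Section Tproj.
Context {n : nat}.
Implicit Types (x : sphere R n) (u v w : 'rV[R]_n.+1).

Lemma tprojD x u v : tproj x (u + v) = tproj x u + tproj x v.
Proof. by rewrite /tproj dotDl scalerDl opprD addrACA. Qed.

Lemma tprojZ x k u : tproj x (k *: u) = k *: tproj x u.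
Proof. by rewrite /tproj dotZl scalerBr scalerA. Qed.

Lemma tprojN x u : tproj x (- u) = - tproj x u.
Proof. by rewrite -scaleN1r tprojZ scaleN1r. Qed.

Lemma tprojB x u v : tproj x (u - v) = tproj x u - tproj x v.
Proof. by rewrite tprojD tprojN. Qed.

Lemma tproj0 x : tproj x 0 = 0.
Proof. by rewrite /tproj dot0l scale0r subr0. Qed.

Lemma tproj_val x : tproj x (val x) = 0.
Proof. by rewrite /tproj dot_sphere scale1r subrr. Qed.

Lemma tproj_id x u : dot u (val x) = 0 -> tproj x u = u.
Proof. by move=> ux; rewrite /tproj ux scale0r subr0. Qed.

Lemma dot_tproj x u : dot (tproj x u) (val x) = 0.
Proof. by rewrite dotBl dotZl dot_sphere mulr1 subrr. Qed.

Lemma tprojK x u : tproj x (tproj x u) = tproj x u.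
Proof. exact/tproj_id/dot_tproj. Qed.

Lemma has_sder_extend x u v :
  has_sder (extend u) x v
    (- (dot u (tproj x v) *: val x + dot u (val x) *: tproj x v)).
Proof.
rewrite -[X in has_sder _ _ _ X]add0r.
apply: has_sderB; first exact: has_sder_cst.
apply: has_sderZ; last exact: has_sder_val.
rewrite -[X in has_sder _ _ _ X]add0r -(dot0l (val x)).
by apply: has_sder_dot; [exact: has_sder_cst|exact: has_sder_val].
Qed.

(** In particular [extend u] is parallel at each point where [u] is tangent, so the correction terms
    of second derivatives vanish there. *)
Lemma nabla_extend (X : sphere R n -> 'rV[R]_n.+1) u x :
  nabla X (extend u) x = - (dot u (val x) *: tproj x (X x)).
Proof.
rewrite /nabla /pullback_nabla (has_sderE (has_sder_extend x u (X x))).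
by rewrite tprojN tprojD !tprojZ tproj_val scaler0 add0r tprojK.
Qed.

(** The inner derivative is [- <w, y> extend v]. Its coefficient vanishes at [x], so only the
    derivative of the coefficient contributes. *)
Lemma nabla_nabla_extend x u v w :
    dot u (val x) = 0 -> dot v (val x) = 0 -> dot w (val x) = 0 ->
  nabla (extend u) (nabla (extend v) (extend w)) x = - (dot u w *: v).
Proof.
move=> ux vx wx.
have -> : nabla (extend v) (extend w) =
    fun y => - (dot w (val y) *: extend v y).
  by apply/funext => y; rewrite nabla_extend tprojK.
have dw : has_sder (fun y => dot w (val y)) x u (dot w u).
  rewrite -{2}(tproj_id ux) -[X in has_sder _ _ _ X]add0r -(dot0l (val x)).
  by apply: has_sder_dot; [exact: has_sder_cst|exact: has_sder_val].
rewrite /nabla /pullback_nabla {2}/extend (tproj_id ux).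
rewrite (has_sderE (has_sderN (has_sderZ dw (has_sder_extend x v u)))).
by rewrite wx scale0r addr0 tprojN tprojZ tprojK (tproj_id vx) dotC.
Qed.

(** Constant sectional curvature 1. The Lie bracket term drops out because [extend w] is parallel at
    [x]. *)
Lemma curvature_sphere x u v w :
    dot u (val x) = 0 -> dot v (val x) = 0 -> dot w (val x) = 0 ->
  curvature_at x u v w = dot v w *: u - dot u w *: v.
Proof.
move=> ux vx wx; rewrite /curvature_at /curvature !nabla_nabla_extend //.
by rewrite nabla_extend wx scale0r oppr0 subr0 opprK addrC.
Qed.

End Tproj.

(** * Vector-valued symmetric bilinear forms *)

Section Quadratic.
Context {m n : nat} (A : 'I_n.+1 -> 'M[R]_m.+1).
Hypothesis Asym : forall k, (A k)^T = A k.
Implicit Types u v w : 'rV[R]_m.+1.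

Definition polar u v : 'rV[R]_n.+1 := \row_k (u *m A k *m v^T) 0 0.
Local Notation B := polar.

Lemma polar_entry u v i k : B u v i k = (u *m A k *m v^T) 0 0.
Proof. by rewrite mxE. Qed.

Lemma polarC u v : B u v = B v u.
Proof.
apply/rowP => k; rewrite !polar_entry -[u *m A k *m v^T]trmxK [_^T^T 0 0]mxE.
by rewrite !trmx_mul trmxK Asym mulmxA.
Qed.

Lemma polarDl u v w : B (u + v) w = B u w + B v w.
Proof. by apply/rowP => k; rewrite [RHS]mxE !polar_entry !mulmxDl mxE. Qed.

Lemma polarZl a u v : B (a *: u) v = a *: B u v.
Proof. by apply/rowP => k; rewrite [RHS]mxE !polar_entry -!scalemxAl mxE. Qed.

Lemma polarDr u v w : B u (v + w) = B u v + B u w.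
Proof. by rewrite polarC polarDl !(polarC _ u). Qed.

Lemma polarZr a u v : B u (a *: v) = a *: B u v.
Proof. by rewrite polarC polarZl polarC. Qed.

Lemma polarNl u v : B (- u) v = - B u v.
Proof. by rewrite -scaleN1r polarZl scaleN1r. Qed.

Lemma polarNr u v : B u (- v) = - B u v.
Proof. by rewrite polarC polarNl polarC. Qed.

Definition polarE := (polarDl, polarDr, polarZl, polarZr, polarNl, polarNr).

Lemma has_sder_polar p (f g : sphere R p -> 'rV[R]_m.+1) x (z : 'rV[R]_p.+1)
    (df dg : 'rV[R]_m.+1) :
  has_sder f x z df -> has_sder g x z dg ->
  has_sder (fun y => B (f y) (g y)) x z (B df (g x) + B (f x) dg).
Proof.
move=> fx gx; apply: has_sder_mx => i k; rewrite mxE !polar_entry.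
rewrite (_ : (fun y => _) = fun y => (f y *m A k *m (g y)^T) 0 0); last first.
  by apply/funext => y; rewrite polar_entry.
have fA := has_sder_mulmx fx (has_sder_cst (A k) x z).
by have /(has_sder_entry 0 0)/has_sder_eq :=
  has_sder_mulmx fA (has_sder_tr gx); apply; rewrite mulmx0 addr0 mxE.
Qed.

End Quadratic.

(** * Energy density, tension and bitension of a quadratic map between spheres *)

Section QuadraticMap.
Context {m n : nat} (A : 'I_n.+1 -> 'M[R]_m.+1).
Hypothesis Asym : forall k, (A k)^T = A k.
Variable phi : sphere R m -> sphere R n.
Local Notation B := (polar A).
Hypothesis phiE : forall x, val (phi x) = B (val x) (val x).
Implicit Types (u v w e : 'rV[R]_m.+1) (x y : sphere R m).
Local Notation polarE := (polarE Asym).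

Lemma has_sder_quadratic x v :
  has_sder (fun y => val (phi y)) x v (2 *: B (val x) (tproj x v)).
Proof.
rewrite (_ : (fun y => _) = fun y => B (val y) (val y)); last exact/funext.
have := has_sder_polar A (has_sder_val x v) (has_sder_val x v).
by move=> /has_sder_eq; apply; rewrite polarC // scaler_nat mulr2n.
Qed.

Lemma differential_quadratic x v :
  differential phi x v = 2 *: B (val x) (tproj x v).
Proof. exact/has_sderE/has_sder_quadratic. Qed.

(** A unit vector [u] is a point of the source sphere, and [B u u] is its image under [phi]. *)
Lemma norm_polar_diag u : dot u u = 1 -> dot (B u u) (B u u) = 1.
Proof.
move=> uu; have u1 : dot u u == 1 by rewrite uu.
by rewrite -(dot_sphere (phi (exist _ u u1))) phiE.
Qed.

(* Expand [|B(su + tv, su + tv)|^2 = 1] at the rational points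
   [(3/5, +-4/5)], [(4/5, +-3/5)] of the unit circle. *)
Lemma dot_polar_orthonormal u v :
    dot u u = 1 -> dot v v = 1 -> dot u v = 0 ->
  dot (B u u) (B u v) = 0 /\
  dot (B u u) (B v v) + 2 * dot (B u v) (B u v) = 1.
Proof.
move=> uu vv uv; have vu : dot v u = 0 by rewrite dotC.
have h s t : s ^+ 2 + t ^+ 2 = 1 ->
    (s ^+ 2) ^+ 2 + (t ^+ 2) ^+ 2 +
      2 * s ^+ 2 * t ^+ 2 * (dot (B u u) (B v v) + 2 * dot (B u v) (B u v)) +
      4 * s * t * (s ^+ 2 * dot (B u u) (B u v) + t ^+ 2 * dot (B v v) (B u v))
    = 1.
  move=> st; have w1 : dot (s *: u + t *: v) (s *: u + t *: v) = 1.
    by rewrite !dotE uu vv uv vu -[RHS]st; ring.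
  have := norm_polar_diag w1; rewrite !polarE (polarC Asym v u) !dotE.
  rewrite (dotC (B v v) (B u u)) (dotC (B u v) (B u u)) (dotC (B u v) (B v v)).
  rewrite (norm_polar_diag uu) (norm_polar_diag vv) => H; rewrite -[RHS]H; ring.
have [] : [/\ (3/5 : R) ^+ 2 + (4/5) ^+ 2 = 1,
    (3/5 : R) ^+ 2 + (- (4/5)) ^+ 2 = 1, (4/5 : R) ^+ 2 + (3/5) ^+ 2 = 1 &
    (4/5 : R) ^+ 2 + (- (3/5)) ^+ 2 = 1].
  by split; field.
by move=> /h h1 /h h2 /h h3 /h h4; split; lra.
Qed.

(** Normalising [v] reduces this to the first relation for orthonormal pairs. It makes [B x v]
    tangent at [phi x], hence fixed by the projection. *)
Lemma dot_polar_tangent x v : dot v (val x) = 0 ->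
  dot (B (val x) v) (val (phi x)) = 0.
Proof.
move=> vx; have [->|v0] := eqVneq v 0.
  by rewrite -(scale0r 0) polarZr // scale0r dot0l.
have vv : 0 < dot v v.
  by rewrite lt0r dotvv_ge0 andbT; apply: contra v0 => /eqP/dotvv_eq0 ->.
pose k := (Num.sqrt (dot v v))^-1.
have k0 : k != 0 by rewrite invr_eq0 gt_eqF // sqrtr_gt0.
have kk : dot (k *: v) (k *: v) = 1.
  by rewrite !dotE mulrA -invfM -expr2 sqr_sqrtr ?ltW // mulVf // gt_eqF.
have xk : dot (val x) (k *: v) = 0 by rewrite dotZr dotC vx mulr0.
have [+ _] := dot_polar_orthonormal (dot_sphere x) kk xk.
rewrite polarZr // dotZr -phiE dotC => /eqP.
by rewrite mulf_eq0 (negbTE k0) /= => /eqP.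
Qed.

(** The form with matrix [A k] has Laplacian [2 tr (A k)] on the ambient space. This is the vector
    [c] of the overview, and [height] below is its [f]. *)
Definition half_laplacian : 'rV[R]_n.+1 := \row_k \tr (A k).
Local Notation c := half_laplacian.

Definition height x : R := dot c (val (phi x)).

Lemma trace_polar x : trace x B = c - val (phi x).
Proof.
apply/rowP => k; rewrite phiE [RHS]mxE [c 0 k]mxE [X in _ + X]mxE polar_entry.
rewrite -trace_mx /trace summxE; apply: eq_bigr => i _.
by rewrite polar_entry.
Qed.

(** Since [extend e] is parallel at [x], only the derivative of [2 B(y, extend e y)] remains. It
    equals [2 (B(e, e) - B(x, x))], and [B(x, x) = phi x] is normal. *)
Lemma nabla_differential_quadratic x e :
    dot e (val x) = 0 -> dot e e = 1 ->
  nabla_differential phi (extend e) (extend e) x = 2 *: tproj (phi x) (B e e).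
Proof.
move=> ex ee; rewrite /nabla_differential nabla_extend ex scale0r oppr0.
rewrite differential_quadratic tproj0 -(scale0r 0) polarZr //.
rewrite !(scale0r, scaler0) subr0.
rewrite /pullback_nabla [extend e x](tproj_id ex).
have -> : (fun y => differential phi y (extend e y)) =
    fun y => 2 *: B (val y) (extend e y).
  by apply/funext => y; rewrite differential_quadratic tprojK.
have := has_sder_polar A (has_sder_val x e) (has_sder_extend x e e).
move=> /(has_sderZc 2)/has_sderE ->.
rewrite !(tproj_id ex) ex ee scale0r scale1r addr0 /extend (tproj_id ex).
by rewrite polarNr // -phiE tprojZ tprojB tproj_val subr0.
Qed.

Lemma eq_trace (V : zmodType) x (b1 b2 : 'rV[R]_m.+1 -> 'rV[R]_m.+1 -> V) :
    (forall e, dot e (val x) = 0 -> dot e e = 1 -> b1 e e = b2 e e) ->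
  trace x b1 = trace x b2.
Proof.
move=> b12; apply: eq_bigr => i _; apply: b12; last exact: dot_frame.
by rewrite dotC dot_frame_l.
Qed.

Lemma tension_quadratic x : tension phi x = 2 *: tproj (phi x) c.
Proof.
rewrite /tension.
transitivity (2 *: tproj (phi x) (trace x B)); last first.
  by rewrite trace_polar tprojB tproj_val subr0.
rewrite (eq_trace (b2 := fun u v => 2 *: tproj (phi x) (B u v))); last first.
  exact: nabla_differential_quadratic.
rewrite /trace -scaler_sumr; congr (_ *: _).
by elim/big_rec2 : _ => [|i ? ? _ ->]; rewrite ?tproj0 ?tprojD.
Qed.

(** For unit tangent [e], polarisation gives [2 |B(x, e)|^2 = 1 - <phi x, B(e, e)>]; the sum over a
    frame is [m - <phi x, c - phi x>]. *)
Lemma trace_dot_polar x :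
  2 * trace x (fun u v => dot (B (val x) u) (B (val x) v)) = m.+1%:R - height x.
Proof.
rewrite (eq_trace (b2 := fun u v => 2^-1 * (1 - dot (val (phi x)) (B u v)))).
  rewrite /trace -mulr_sumr mulrA mulfV ?pnatr_eq0 // mul1r big_split /=.
  rewrite sumr_const card_ord sumrN -dot_sumr.
  rewrite -/(trace x B) trace_polar dotBr dot_sphere dotC /height -natr1; ring.
move=> e ex ee; have xe : dot (val x) e = 0 by rewrite dotC.
have [_] := dot_polar_orthonormal (dot_sphere x) ee xe; rewrite -phiE; lra.
Qed.

Lemma energy_density_quadratic x : energy_density phi x = m.+1%:R - height x.
Proof.
rewrite /energy_density -trace_dot_polar.
rewrite (eq_trace (b2 := fun u v => 4 * dot (B (val x) u) (B (val x) v))).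
  by rewrite /trace -mulr_sumr; field.
move=> e ex _; rewrite !differential_quadratic (tproj_id ex) !dotE; ring.
Qed.

Lemma has_sder_height x v :
  has_sder height x v (2 * dot c (B (val x) (tproj x v))).
Proof.
have := has_sder_dot (has_sder_cst c x v) (has_sder_quadratic x v).
by move=> /has_sder_eq; apply; rewrite dot0l add0r dotZr.
Qed.

(** Differentiate [2 (c - f phi)]: [c] is constant, the term in [df] is normal, and [dphi]
    contributes another factor 2. *)
Lemma pullback_nabla_tension x v :
  pullback_nabla phi (extend v) (tension phi) x =
  - (4 * height x) *: B (val x) (extend v x).
Proof.
have -> : tension phi = fun y => 2 *: (c - height y *: val (phi y)).
  by apply/funext => y; rewrite tension_quadratic.
rewrite /pullback_nabla.
have := has_sderZ (has_sder_height x (extend v x))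
  (has_sder_quadratic x (extend v x)).
move=> /(has_sderB (has_sder_cst c _ _))/(has_sderZc 2)/has_sderE ->.
rewrite tprojZ add0r tprojN tprojD !tprojZ tproj_val scaler0 add0r tprojK.
rewrite tproj_id; last by rewrite dot_polar_tangent // dot_tproj.
by rewrite scalerN !scalerA scaleNr; congr (- (_ *: _)); ring.
Qed.

Lemma nabla2_tension x e : dot e (val x) = 0 -> dot e e = 1 ->
  nabla2 phi (tension phi) (extend e) (extend e) x =
  - (8 * dot c (B (val x) e)) *: B (val x) e
  - (4 * height x) *: tproj (phi x) (B e e).
Proof.
(* The correction term is a derivative along the zero vector. *)
move=> ex ee; rewrite /nabla2 {3}/pullback_nabla nabla_extend ex scale0r oppr0.
rewrite /sder derive0 tproj0 subr0.
have -> : pullback_nabla phi (extend e) (tension phi) =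
    fun y => - (4 *: (height y *: B (val y) (extend e y))).
  by apply/funext => y; rewrite pullback_nabla_tension scalerA scaleNr.
rewrite /pullback_nabla [extend e x](tproj_id ex).
have := has_sder_polar A (has_sder_val x e) (has_sder_extend x e e).
move=> /(has_sderZ (has_sder_height x e))/(has_sderZc 4)/has_sderN/has_sderE.
rewrite /sder => ->.
rewrite !(tproj_id ex) ex ee scale0r scale1r addr0 /extend (tproj_id ex).
rewrite polarNr // -phiE tprojN tprojZ tprojD !tprojZ tprojB tproj_val subr0.
rewrite (tproj_id (dot_polar_tangent ex)) scalerDr opprD !scalerA scaleNr.
by congr (- (_ *: _) - _); ring.
Qed.

(** Constant curvature applied to [2 B(x, e)] and [2 V]; as [B(x, e)] is tangent,
    [<V, B(x, e)> = <c, B(x, e)>]. *)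
Lemma curvature_tension x e : dot e (val x) = 0 ->
  curvature_at (phi x) (differential phi x e) (tension phi x)
      (differential phi x e) =
  (8 * dot c (B (val x) e)) *: B (val x) e
  - (8 * dot (B (val x) e) (B (val x) e)) *: tproj (phi x) c.
Proof.
move=> ex; have Bx := dot_polar_tangent ex.
rewrite differential_quadratic (tproj_id ex) tension_quadratic.
rewrite curvature_sphere ?dotZl ?Bx ?dot_tproj ?mulr0 //.
rewrite /tproj !dotE (dotC (val (phi x))) Bx !scalerA.
by congr (_ *: _ - _ *: _); ring.
Qed.

(** The rough Laplacian and the curvature each contribute [-8] to the first coefficient. For [V]
    they contribute [-4 f] and [8] times the trace of [|B(x, e)|^2], that is [4 (m + 1 - f)]. *)
Lemma bitension_quadratic x :
  bitension phi x =
  - 16 *: trace x (fun u v => dot c (B (val x) u) *: B (val x) v)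
  + (4 * (m.+1%:R - 2 * height x)) *: tproj (phi x) c.
Proof.
pose b1 u v := dot c (B (val x) u) *: B (val x) v.
pose b2 u v := dot (B (val x) u) (B (val x) v).
rewrite /bitension /rough_laplacian opprK -sumrB.
transitivity (trace x (fun u v => - 16 *: b1 u v
    - (4 * height x) *: tproj (phi x) (B u v)
    + (8 * b2 u v) *: tproj (phi x) c)).
  apply: eq_bigr => i _; have ee := dot_frame x i.
  have ex : dot (row i (frame x)) (val x) = 0 by rewrite dotC dot_frame_l.
  rewrite nabla2_tension // curvature_tension // /b1 /b2.
  apply/rowP => k; rewrite !mxE; ring.
rewrite /trace !big_split /= -scaler_sumr -addrA; congr (_ + _).
rewrite sumrN -scaler_sumr -scaler_suml -mulr_sumr.
have -> : \sum_i tproj (phi x) (B (row i (frame x)) (row i (frame x))) =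
    tproj (phi x) c.
  transitivity (tproj (phi x) (trace x B)).
    rewrite /trace; elim/big_rec2 : _ => [|i ? ? _ ->]; first by rewrite tproj0.
    by rewrite tprojD.
  by rewrite trace_polar tprojB tproj_val subr0.
rewrite -scaleNr -scalerDl; congr (_ *: _).
have := trace_dot_polar x; rewrite /trace -/b2 => h; lra.
Qed.

End QuadraticMap.

(* On the circle [2 g ^ 3] agrees with a form of degree 4, so by homogeneity
   [s ^ 2 + t ^ 2] divides [g ^ 3], which thus vanishes at [(s, t) = (1, i)],
   where [g = P + i Q].  The real and imaginary parts of [(P + i Q) ^ 3 = 0] are linear
   consequences of the hypothesis at rational points of the circle. *)
Lemma circle_cubic (a b d p q r k l : R) :
    (forall s t, s ^+ 2 + t ^+ 2 = 1 ->
      let g := a * s ^+ 2 + 2 * b * s * t + d * t ^+ 2 in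
      4 * (p * s ^+ 2 + q * s * t + r * t ^+ 2 - g ^+ 2) =
      (k - 2 * g) * (l - g ^+ 2)) ->
  a = d /\ b = 0.
Proof.
move=> H; pose P := a - d; pose Q := 2 * b.
have [e1 e2 e3 e4] : [/\ (1 : R) ^+ 2 + 0 ^+ 2 = 1, (0 : R) ^+ 2 + 1 ^+ 2 = 1,
  (3/5 : R) ^+ 2 + (4/5) ^+ 2 = 1 & (3/5 : R) ^+ 2 + (- (4/5)) ^+ 2 = 1].
  by split; field.
have [e5 e6 e7 e8] : [/\ (4/5 : R) ^+ 2 + (3/5) ^+ 2 = 1,
  (4/5 : R) ^+ 2 + (- (3/5)) ^+ 2 = 1, (5/13 : R) ^+ 2 + (12/13) ^+ 2 = 1 &
  (5/13 : R) ^+ 2 + (- (12/13)) ^+ 2 = 1].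
  by split; field.
have h1 := H _ _ e1; have h2 := H _ _ e2; have h3 := H _ _ e3.
have h4 := H _ _ e4; have h5 := H _ _ e5; have h6 := H _ _ e6.
have h7 := H _ _ e7; have h8 := H _ _ e8.
have PQ : P * (P ^+ 2 - 3 * Q ^+ 2) = 0.
  rewrite /P /Q; clear - h1 h2 h3 h4 h5 h6 h7 h8; cbv zeta in *; lra.
have QP : Q * (3 * P ^+ 2 - Q ^+ 2) = 0.
  rewrite /P /Q; clear - h1 h2 h3 h4 h5 h6 h7 h8; cbv zeta in *; lra.
(* This is [|P + i Q|^6], the sum of the squares of the real and imaginary parts of the cube. *)
have : (P ^+ 2 + Q ^+ 2) ^+ 3 = 0.
  transitivity ((P * (P ^+ 2 - 3 * Q ^+ 2)) ^+ 2 +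
      (Q * (3 * P ^+ 2 - Q ^+ 2)) ^+ 2); first by ring.
  by rewrite PQ QP; ring.
move=> /eqP; rewrite expf_eq0 /= paddr_eq0 ?sqr_ge0 // !sqrf_eq0 /P /Q.
by move=> /andP[/eqP P0 /eqP Q0]; split; lra.
Qed.

(** * Homogeneous polynomials of degree 2 as symmetric matrices *)

Import (canonicals) mpoly.

Lemma mdeg_eq2 N (mm : mpoly.multinom N) : mpoly.mdeg mm = 2%N ->
  exists i j, mm = mpoly.mnm_add (mpoly.mnm1 i) (mpoly.mnm1 j).
Proof.
move=> mm2; have [i mmi] : exists i, mpoly.fun_of_multinom mm i != 0%N.
  apply/existsP; rewrite -[X in is_true X]negbK; apply/negP => /existsPn mm0.
  suff : mpoly.mdeg mm = 0%N by rewrite mm2.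
  by rewrite mpoly.mdegE big1 // => i _; apply/eqP; rewrite -[_ == _]negbK.
move: mmi; rewrite -mpoly.lep1mP => /mpoly.submK mmE.
have /eqP/mpoly.mdeg1P[j /eqP mmj] :
    mpoly.mdeg (mpoly.mnm_sub mm (mpoly.mnm1 i)) = 1%N.
  have := congr1 mpoly.mdeg mmE.
  by rewrite mpoly.mdegD mpoly.mdeg1 mm2 addn1 => -[].
by exists j, i; rewrite -mmj mmE.
Qed.

(** Each monomial [X_i X_j] is the form of an elementary matrix; symmetrising the resulting sum does
    not change its quadratic form. *)
Lemma meval_dhomog2 N (F : mpoly.dhomog N R 2) :
  exists M : 'M[R]_N, M^T = M /\
    forall u : 'rV[R]_N,
      mpoly.meval (fun j => u 0 j) (mpoly.mpoly_of_dhomog F) =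
        (u *m M *m u^T) 0 0.
Proof.
suff [M MF] : exists M : 'M[R]_N, forall u : 'rV[R]_N,
    mpoly.meval (fun j => u 0 j) (mpoly.mpoly_of_dhomog F) =
        (u *m M *m u^T) 0 0.
  exists (2^-1 *: (M + M^T)); split.
    by rewrite linearZ linearD /= trmxK addrC.
  move=> u; rewrite MF -scalemxAr -scalemxAl mulmxDr mulmxDl [RHS]mxE.
  rewrite [X in _ = _ * X]mxE.
  have -> : (u *m M^T *m u^T) 0 0 = (u *m M *m u^T) 0 0.
    by rewrite -[u *m M^T *m u^T]trmxK [LHS]mxE !trmx_mul !trmxK mulmxA.
  by field.
case: F => F /= /mpoly.dhomogP homF.
pose F_u (u : 'rV[R]_N) mm :=
  mpoly.mcoeff mm F * \prod_i u 0 i ^+ mpoly.fun_of_multinom mm i.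
(* Induction over lists inside the support keeps every monomial of degree 2. *)
suff : forall s : seq (mpoly.multinom N), {subset s <= mpoly.msupp F} ->
    exists M : 'M[R]_N, forall u : 'rV[R]_N,
    \sum_(mm <- s) F_u u mm =
    (u *m M *m u^T) 0 0.
  by move=> /(_ _ (fun _ => id))[M MF]; exists M => u; rewrite mpoly.mevalE MF.
elim=> [_|mm s IHs sF].
  by exists 0 => u; rewrite big_nil mulmx0 mul0mx mxE.
have [M MF] : exists M : 'M[R]_N, forall u : 'rV[R]_N,
   \sum_(mm <- s) F_u u mm =
    (u *m M *m u^T) 0 0.
  by apply: IHs => i si; apply: sF; rewrite inE si orbT.
have mm2 : mpoly.mdeg mm = 2%N by apply: homF; apply: sF; rewrite inE eqxx.
have [i [j mmE]] := mdeg_eq2 mm2.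
exists (M + mpoly.mcoeff mm F *: delta_mx i j) => u.
rewrite big_cons MF /F_u mulmxDr mulmxDl [RHS]mxE addrC; congr (_ + _).
rewrite -scalemxAr -scalemxAl [RHS]mxE; congr (_ * _).
rewrite (eq_bigr (fun k => u 0 k ^+ (i == k) * u 0 k ^+ (j == k))); last first.
  by move=> k _; rewrite mmE mpoly.mnmDE !mpoly.mnm1E exprD.
rewrite big_split /=.
have pr (k : 'I_N) : \prod_l u 0 l ^+ (k == l) = u 0 k.
  rewrite (bigD1 k) //= eqxx big1 ?mulr1 // => l /negbTE; rewrite eq_sym => ->.
  by rewrite expr0.
rewrite !pr -(mul_delta_mx (0 : 'I_1)) -[delta_mx i 0]trmx_delta !mulmxA.
rewrite -(mulmxA (u *m _)) [RHS]mxE big_ord1 !dot_mx dot_delta.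
by rewrite dotC dot_delta.
Qed.

Lemma quadratic_form_polar m n (phi : sphere R m -> sphere R n) :
  quadratic_form phi ->
  exists A : 'I_n.+1 -> 'M[R]_m.+1, (forall k, (A k)^T = A k) /\
    forall x, val (phi x) = polar A (val x) (val x).
Proof.
move=> [F FE]; have [A AF] := choice (fun k => meval_dhomog2 (F k)).
exists A; split=> [k|x]; first by have [] := AF k.
rewrite FE; apply/rowP => k; rewrite polar_entry mxE.
by have [_ ->] := AF k.
Qed.

(** Restricting to the unit circle in each coordinate plane, [circle_cubic] equates two diagonal
    entries and kills the off-diagonal one. *)
Lemma cubic_identity_scalar m (C : 'M[R]_m.+1) k l :
    C^T = C ->
    (forall u : 'rV[R]_m.+1, dot u u = 1 ->
      4 * (dot (u *m C) (u *m C) - dot (u *m C) u ^+ 2) =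
      (k - 2 * dot (u *m C) u) * (l - dot (u *m C) u ^+ 2)) ->
  exists a, C = a%:M.
Proof.
move=> Csym H; exists (C 0 0).
pose d i : 'rV[R]_m.+1 := delta_mx 0 i.
have dd i j : dot (d i) (d j) = (i == j)%:R.
  by rewrite dot_delta mxE eqxx eq_sym.
have dC i j : dot (d i *m C) (d j) = C i j by rewrite dot_delta -rowE mxE.
have Cij i j : C i j = C j i by rewrite -[in LHS]Csym mxE.
have h i j : i != j -> C i i = C j j /\ C i j = 0.
  (* The supplied values are the coefficients of [|u C|^2] for [u = s d_i + t d_j]. *)
  move=> ij; apply: (@circle_cubic _ _ _ (dot (d i *m C) (d i *m C))
    (2 * dot (d i *m C) (d j *m C)) (dot (d j *m C) (d j *m C)) k l).
  move=> s t st g.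
  have w1 : dot (s *: d i + t *: d j) (s *: d i + t *: d j) = 1.
    rewrite !dotE !dd !eqxx (eq_sym j) (negbTE ij) -[RHS]st /=; ring.
  have := H _ w1; rewrite mulmxDl -!scalemxAl !dotE !dC (Cij j i).
  rewrite (dotC (d j *m C) (d i *m C)) => e.
  have gE : g = s * (s * C i i + t * C i j) + t * (s * C i j + t * C j j).
    by rewrite /g; ring.
  move: e; rewrite gE => e; lra.
apply/matrixP => i j; rewrite mxE; have [<-|ij] := eqVneq i j.
  by have [->//|i0] := eqVneq i 0; have [] := h i 0 i0.
by have [_ ->] := h i j ij.
Qed.

(** * The biharmonic equation and the height function *)

Section BiharmonicQuadratic.
Context {m n : nat} (A : 'I_n.+1 -> 'M[R]_m.+1).
Hypothesis Asym : forall k, (A k)^T = A k.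
Variable phi : sphere R m -> sphere R n.
Local Notation B := (polar A).
Hypothesis phiE : forall x, val (phi x) = B (val x) (val x).
Local Notation c := (half_laplacian A).
Local Notation ht := (height A phi).

(** The symmetric matrix [C] of the quadratic form [f]; on the sphere
    [|grad f|^2 = 4 (|x C|^2 - f^2)]. *)
Definition height_mx : 'M[R]_m.+1 := \sum_k c 0 k *: A k.

Lemma tr_height_mx : height_mx^T = height_mx.
Proof.
rewrite linear_sum /=; apply: eq_bigr => k _.
by rewrite linearZ /= Asym.
Qed.

Lemma dot_height_mx u v : dot c (B u v) = dot (u *m height_mx) v.
Proof.
rewrite -[RHS]dot_mx mulmx_sumr mulmx_suml summxE; apply: eq_bigr => k _.
by rewrite polar_entry -scalemxAr -scalemxAl [RHS]mxE.
Qed.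

(** Pair the bitension field with [c]: the trace becomes [|x C|^2 - f^2] by Parseval, and
    [<c, V> = |c|^2 - f^2]. *)
Lemma biharmonic_identity x : bitension phi x = 0 ->
  4 * (dot (val x *m height_mx) (val x *m height_mx) - ht x ^+ 2) =
  (m.+1%:R - 2 * ht x) * (dot c c - ht x ^+ 2).
Proof.
move=> /(congr1 (dot c)); rewrite (bitension_quadratic Asym phiE) dot0r.
rewrite dotDr !dotZr /tproj dotBr dotZr.
have -> : dot c (trace x (fun u v => dot c (B (val x) u) *: B (val x) v)) =
    dot (val x *m height_mx) (val x *m height_mx) - ht x ^+ 2.
  rewrite /height phiE dot_height_mx expr2 -trace_dot /trace dot_sumr.
  by apply: eq_bigr => i _; rewrite dotZr !dot_height_mx.
rewrite -/(ht x); lra.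
Qed.

Lemma biharmonic_height : biharmonic phi -> ~ Defs.harmonic phi ->
  forall x, ht x = m.+1%:R / 2.
Proof.
move=> bih nharm.
have bid x := biharmonic_identity (bih x).
have hE x : ht x = dot (val x *m height_mx) (val x).
  by rewrite /height phiE dot_height_mx.
have [a Ca] : exists a, height_mx = a%:M.
  apply: (cubic_identity_scalar tr_height_mx (k := m.+1%:R) (l := dot c c)).
  move=> u /eqP uu; have := bid (exist _ u uu); rewrite hE; exact.
have ha x : ht x = a by rewrite hE Ca mul_mx_scalar dotZl dot_sphere mulr1.
(* With [f = a] constant the gradient side vanishes, so one factor of the other side is zero; the
   second factor is [|V|^2]. *)
move=> x; rewrite ha; have /esym/eqP := bid x; rewrite ha Ca mul_mx_scalar.
rewrite !dotZl dotZr dot_sphere mulr1 -expr2 subrr mulr0 mulf_eq0.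
move=> /orP[/eqP|/eqP c0]; first by lra.
case: nharm => y; rewrite (tension_quadratic Asym phiE).
suff -> : tproj (phi y) c = 0 by rewrite scaler0.
apply: dotvv_eq0; rewrite /tproj -/(ht y) ha !dotE dot_sphere.
rewrite (dotC _ c) -/(ht y) ha -[RHS]c0; ring.
Qed.

(** Constancy of [f] makes every [<c, B(x, e)>] vanish, and its value annihilates the coefficient of
    [V]. *)
Lemma height_biharmonic : ~ constant_map phi ->
  (forall x, ht x = m.+1%:R / 2) -> proper_biharmonic phi.
Proof.
move=> nconst hE; split=> [x|harm].
  rewrite (bitension_quadratic Asym phiE) hE mulrCA mulfV ?pnatr_eq0 //.
  rewrite mulr1 subrr mulr0 scale0r addr0 /trace big1 ?scaler0 // => i _.
  have dh := has_sder_height Asym phiE x (row i (frame x)).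
  have h0 : has_sder ht x (row i (frame x)) 0.
    by rewrite (_ : ht = fun=> m.+1%:R / 2); [exact: has_sder_cst|exact/funext].
  have := has_sderE dh; rewrite (has_sderE h0) tproj_id; last first.
    by rewrite dotC dot_frame_l.
  move=> /esym/eqP; rewrite mulf_eq0 pnatr_eq0 /= => /eqP ->.
  by rewrite scale0r.
(* Harmonicity means [c = f phi]; as [f] is a nonzero constant, [phi] would be constant. *)
apply: nconst; exists (phi (north R m)) => x; apply: val_inj.
have m0 : m.+1%:R / 2 != 0 :> R by rewrite mulf_neq0 ?invr_eq0 ?pnatr_eq0.
suff h y : c = (m.+1%:R / 2) *: val (phi y).
  by apply: (scalerI m0); rewrite -!h.
have /eqP := harm y; rewrite (tension_quadratic Asym phiE) scaler_eq0.
by rewrite pnatr_eq0 /= subr_eq0 -/(ht y) hE => /eqP.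
Qed.

End BiharmonicQuadratic.

End QuadraticForms.

Theorem theorem3p1 (R : realType) (m n : nat) (hm : (1 <= m)%N) (hn : (1 <= n)%N)
    (phi : sphere R m -> sphere R n)
    (hquad : quadratic_form phi) (hnonconst : ~ constant_map phi) :
  proper_biharmonic phi <->
  (forall x : sphere R m, energy_density phi x = (m.+1)%:R / 2).
Proof.
(* As [e(phi) = m + 1 - f], the energy condition says exactly [f = (m + 1) / 2]. *)
have [A [Asym phiE]] := quadratic_form_polar hquad.
have eE x := energy_density_quadratic Asym phiE x.
split=> [[bih nharm] x|he].
  by rewrite eE (biharmonic_height Asym phiE bih nharm); field.
apply: (height_biharmonic Asym phiE hnonconst) => x.
have := he x; rewrite eE; lra.
Qed.
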